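(* For any $\varepsilon>0$, there exists a control $u^\varepsilon\in\mathcal{U}$ such that $$J(u^\varepsilon)\le\inf_{u\in\mathcal{U}}J(u)+\varepsilon.$$
   Context: Fix $T>0$, a dimension $d\ge1$ and $\xi\in\mathbb{R}^d$. $\Omega:=C([0,T];\mathbb{R}^d)$ with the topology of uniform convergence and Borel $\sigma$-field $\mathcal{F}$; $|w|_t:=\sup_{0\le s\le t}|w_s|$. $x=(x_t)_{t\le T}$ is the coordinate process, $\mathcal{F}^0_t:=\sigma(x_s,s\le t)$. The function $\sigma:[0,T]\times\Omega\to\mathbb{R}^{d\times d}$ is $\mathcal{F}^0_t$-progressively measurable, there is $C>0$ with $|\sigma(t,w)-\sigma(t,\bar w)|\le C|w-\bar w|_t$ for all $t\in[0,T]$, $w,\bar w\in\Omega$, $\sigma$ is invertible, and $\sigma$ and $\sigma^{-1}$ are bounded. $P$ is a probability measure on $\Omega$ such that $(\Omega,P)$ carries a Brownian motion $W$ and the coordinate process is the unique solution of $dx_t=\sigma(t,x_\cdot)dW_t$, $x_0=\xi$. $\mathbb{F}=(\mathcal{F}_t)_{t\le T}$ is the completion of $(\mathcal{F}^0_t)$ with the $P$-null sets; progressively measurable means w.r.t. $\mathbb{F}$. $\mathcal{P}(\mathbb{R}^d)$, $\mathcal{P}(\Omega)$: sets of probability measures; $d(\mu,\nu)=2\sup_{B\in\mathcal{B}(\mathbb{R}^d)}|\mu(B)-\nu(B)|$ (total variation). Controls: $(U,\delta)$ is a compact metric space and $\mathcal{U}$ is the set of progressively measurable $U$-valued processes $u=(u_t)_{t\le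 T}$. The measurable functions $f,h:[0,T]\times\Omega\times\mathcal{P}(\mathbb{R}^d)\times U\to\mathbb{R}^d$, resp. $\mathbb{R}$, and $g:\mathbb{R}^d\times\mathcal{P}(\mathbb{R}^d)\to\mathbb{R}$ satisfy: - for all $u\in\mathcal{U}$, $Q\in\mathcal{P}(\Omega)$, the processes $f(t,x_\cdot,Q\circ x_t^{-1},u_t)$ and $h(t,x_\cdot,Q\circ x_t^{-1},u_t)$ are progressively measurable and $g(x_T,Q\circ x_T^{-1})$ is $\mathcal{F}_T$-measurable; - $|\phi(t,w,\mu,u)-\phi(t,w,\nu,v)|\le C(d(\mu,\nu)+\delta(u,v))$ for $\phi\in\{f,h\}$, and $|g(y,\mu)-g(y,\nu)|\le C\,d(\mu,\nu)$, for all arguments; - $|f(t,w,\mu,u)|\le C(1+|w|_t)$; - $h$ and $g$ are uniformly bounded. For $u\in\mathcal{U}$, $P^u$ is the unique probability measure on $(\Omega,\mathcal{F})$ satisfying $dP^u=L^u_TdP$ with $L^u_t=\mathcal{E}_t\left(\int_0^\cdot\sigma^{-1}(s,x_\cdot)f(s,x_\cdot,P^u\circ x_s^{-1},u_s)dW_s\right)$, where $\mathcal{E}_t(M)=\exp(M_t-\tfrac12\langle M\rangle_t)$. $E^u$ is expectation under $P^u$. The cost functional is $J(u):=E^u\left[\int_0^Th(t,x_\cdot,P^u\circ x_t^{-1},u_t)dt+g(x_T,P^u\circ x_T^{-1})\right]$. A control $u^\varepsilon$ as in the claim is called near-optimal or $\varepsilon$-optimal. *)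

(* Defs.v *)
From HB Require Import structures.
From mathcomp Require Import all_boot all_order all_algebra.
From mathcomp Require Import all_classical all_reals all_analysis.

Set Implicit Arguments.
Unset Strict Implicit.
Unset Printing Implicit Defensive.
Import Order.TTheory GRing.Theory Num.Theory.
Import numFieldNormedType.Exports.
Local Open Scope classical_set_scope.
Local Open Scope ring_scope.

Definition dotv (R : realType) d (x y : 'cV[R]_d) : R :=
  \sum_(i < d) x i 0 * y i 0.

(* Euclidean norm of a column vector, Frobenius norm of a matrix. *)
Definition enorm (R : realType) m n (A : 'M[R]_(m, n)) : R :=
  Num.sqrt (\sum_(i < m) \sum_(j < n) A i j ^+ 2).

(* Sigma-algebras are handled as set systems where several of them live on the
   same type (filtrations), or where the type is not pointed. *)
Definition prod_sigma (A B : Type) (G : set_system A) (H : set_system B) :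
  set_system (A * B) := <<s [set X `*` Y | X in G & Y in H] >>.

Definition borel (S : topologicalType) : set_system S := <<s @open S >>.
Arguments borel : clear implicits.

Notation Rd R d := (g_sigma_algebraType (@open 'cV[R]_d)).

Section path_space.
Context (R : realType) (T : {posnum R}) (d : nat).

Definition horizon : set R := `[0, T%:num].

Definition cpath := continuousType (set_type horizon) 'cV[R]_d.

Let cpath0_continuous : continuous (fun _ : set_type horizon => 0 : 'cV[R]_d).
Proof. exact: cst_continuous. Qed.

HB.instance Definition _ := Choice.on cpath.
HB.instance Definition _ := isPointed.Build cpath (mkcts cpath0_continuous).

Definition uniform_open : set_system cpath :=
  @open (initial_topology
    (fun w : cpath => (w : {uniform (set_type horizon) -> 'cV[R]_d}))).

Definition Path := g_sigma_algebraType uniform_open.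
HB.instance Definition _ := Measurable.on Path.

Let clip_subproof (t : R) : Num.max 0 (Num.min t T%:num) \in horizon.
Proof.
rewrite inE /horizon /= in_itv /= le_max lexx /= ge_max ge_min lexx orbT andbT.
exact: ge0.
Qed.

(* Retraction of the line onto the time interval, so that every process can be
   indexed by R; only its values on the time interval matter. *)
Definition clip (t : R) : set_type horizon := 
  exist (fun s => s \in horizon) _ (clip_subproof t).

Definition coord (t : R) (w : Path) : Rd R d := (w : cpath) (clip t).

Lemma measurable_coord (t : R) : measurable_fun setT (coord t).
Proof.
apply: measurability => // _ [B oB <-]; rewrite setTI; apply: sub_sigma_algebra.
exists [set f | B (f (clip t))] => //.
rewrite openE => f Bf; apply/uniform_nbhs.
have /nbhsP[E entE EB] : nbhs (f (clip t)) B by exact: open_nbhs_nbhs.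
exists E; split => // g fg; apply: EB; apply/xsectionP; exact: fg.
Qed.

HB.instance Definition _ (t : R) :=
  isMeasurableFun.Build _ _ _ _ (coord t) (measurable_coord t).

End path_space.

Section completion.
Context d (S : measurableType d) (R : realType) (Q : probability S R).

(* The sigma-algebra of the sets that are Caratheodory measurable for the outer
   measure of Q is, Q being finite, the Q-completion of that of S. *)
Definition completion := @completed_measure_extension _ S R Q.
Arguments completion : clear implicits.

HB.instance Definition _ := Measure.on completion.

Let completion_setT : completion setT = 1%E.
Proof.
by rewrite -(probability_setT Q) /completion /completed_measure_extension
  measurable_mu_extE.
Qed.

HB.instance Definition _ :=
  Measure_isProbability.Build _ _ _ completion completion_setT.

End completion.
Arguments completion {d S R} Q _.

Section total_variation.
Context (R : realType) (d : nat).

Definition tv_dist (mu nu : probability (Rd R d) R) : R :=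
  2 * sup [set `|fine (mu B) - fine (nu B)| | B in @measurable _ (Rd R d)].

(* Borel sigma-algebra of the metric space of probability measures with the
   total variation distance. *)
Definition tv_borel : set_system (probability (Rd R d) R) :=
  <<s [set A | forall mu, A mu ->
        exists2 r : R, 0 < r & forall nu, tv_dist mu nu < r -> A nu] >>.

End total_variation.

Section processes.
Context (R : realType) (T : {posnum R}) (d : nat).
Local Notation Om := (Path T d).
Local Notation horizon := (horizon T).
Local Notation V := ('cV[R]_d).

Definition path_sup (t : R) (w : Om) : R :=
  sup [set enorm (coord s w : V) | s in `[0, t]].

Definition path_sub_sup (t : R) (w w' : Om) : R :=
  sup [set enorm ((coord s w : V) - coord s w') | s in `[0, t]].

Definition raw_filtration (t : R) : set_system Om :=
  <<s \bigcup_(s in `[0, t]) preimage_set_system setT (coord s) measurable >>.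

Definition filtration (P : probability Om R) (t : R) : set_system Om :=
  <<s raw_filtration t `|` P.-negligible >>.

Definition progressive (S : topologicalType) (F : R -> set_system Om)
    (X : R -> Om -> S) : Prop :=
  forall t, horizon t -> forall B, borel S B ->
    prod_sigma (@measurable _ R) (F t)
      [set p | 0 <= p.1 <= t /\ B (X p.1 p.2)].

Definition measurable_wrt (S : topologicalType) (F : set_system Om)
    (X : Om -> S) : Prop :=
  forall B, borel S B -> F (X @^-1` B).

Definition adapted (S : topologicalType) (F : R -> set_system Om)
    (X : R -> Om -> S) : Prop :=
  forall t, horizon t -> measurable_wrt (F t) (X t).

Definition ae_continuous (S : topologicalType) (P : probability Om R)
    (X : R -> Om -> S) : Prop :=
  \forall w \ae P, {within horizon, continuous (X ^~ w)}.

Definition in_prob0 (P : probability Om R) (X : nat -> Om -> \bar R) : Prop :=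
  forall e : R, 0 < e ->
    completion P [set w | e%:E < X n w]%E @[n --> \oo] --> 0%E.

Definition brownian (P : probability Om R) (W : R -> Om -> V) : Prop :=
  [/\ adapted (filtration P) W,
      ae_continuous P W,
      \forall w \ae P, W 0 w = 0 &
      (* increments independent of the past, with law N(0, (t - s) Id) *)
      forall s t, 0 <= s -> s < t -> t <= T%:num ->
      forall A, filtration P s A ->
      forall B : 'I_d -> set R, (forall i, measurable (B i)) ->
        completion P (A `&` [set w | forall i, B i ((W t w - W s w) i 0)]) =
        (completion P A *
          \prod_(i < d) normal_prob 0 (Num.sqrt (t - s)) (B i))%E].

(* The process equal to coef k on ]time k, time k.+1] for k < size. *)
Record simple_process := SimpleProcess {
  sp_size : nat;
  sp_time : nat -> R;
  sp_coef : nat -> Om -> V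
}.

Definition subdivision (n : nat) (tau : nat -> R) (t : R) : Prop :=
  [/\ tau 0%N = 0, tau n = t & forall k, (k < n)%N -> tau k <= tau k.+1].

Definition simple_integrand (P : probability Om R) (S : simple_process) : Prop :=
  subdivision (sp_size S) (sp_time S) T%:num /\
  forall k, (k < sp_size S)%N ->
    measurable_wrt (filtration P (sp_time S k)) (sp_coef S k) /\
    exists C : R, forall w, enorm (sp_coef S k w) <= C.

Definition simple_value (S : simple_process) (t : R) (w : Om) : V :=
  \sum_(k < sp_size S | sp_time S k < t <= sp_time S k.+1) sp_coef S k w.

Definition simple_integral (W : R -> Om -> V) (S : simple_process)
    (t : R) (w : Om) : R :=
  \sum_(k < sp_size S)
    dotv (sp_coef S k w)
      (W (Num.min (sp_time S k.+1) t) w - W (Num.min (sp_time S k) t) w).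

Definition l2_dist (H K : R -> Om -> V) (w : Om) : \bar R :=
  (\int[lebesgue_measure]_(s in horizon)
     (enorm (H s w - K s w) ^+ 2)%:E)%E.

(* M is (a version of) the Ito integral int_0^. H . dW, where
   H . dW = sum_i H^i dW^i. *)
Definition is_ito_integral (P : probability Om R) (W H : R -> Om -> V)
    (M : R -> Om -> R) : Prop :=
  [/\ progressive (filtration P) H /\
        (\forall w \ae P, (l2_dist H (fun _ _ => 0%R) w < +oo)%E),
      adapted (filtration P) M,
      ae_continuous P M &
      exists S : nat -> simple_process,
        [/\ forall n, simple_integrand P (S n),
            in_prob0 P (fun n w => l2_dist (simple_value (S n)) H w) &
            in_prob0 P (fun n w => ereal_sup
              [set `|simple_integral W (S n) t w - M t w|%:E | t in horizon])]].

(* Q is (a version of) the quadratic variation <M>. *)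
Definition is_quadratic_variation (P : probability Om R) (M Q : R -> Om -> R) :
    Prop :=
  [/\ adapted (filtration P) Q,
      ae_continuous P Q &
      forall t, horizon t -> forall e e' : R, 0 < e -> 0 < e' ->
      exists2 r : R, 0 < r &
      forall n tau, subdivision n tau t ->
        (forall k, (k < n)%N -> tau k.+1 - tau k < r) ->
        (completion P [set w |
          (e < `|\sum_(k < n) (M (tau k.+1) w - M (tau k) w) ^+ 2 - Q t w|)%R]
         < e'%:E)%E].

Definition doleans_exp (M Q : R -> Om -> R) (t : R) (w : Om) : R :=
  expR (M t w - Q t w / 2).

(* The process X (given as a random path) solves dX = sigma(t, X) dW, X_0 = xi. *)
Definition sde_solution (P : probability Om R) (W : R -> Om -> V)
    (sigma : R -> Om -> 'M[R]_d) (xi : V) (X : Om -> Om) : Prop :=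
  (\forall w \ae P, (coord 0 (X w) : V) = xi) /\
  forall i : 'I_d,
    is_ito_integral P W
      (fun t w => (row i (sigma t (X w)))^T)
      (fun t w => ((coord t (X w) : V) - xi) i 0).

Definition coordinate_unique_solution (P : probability Om R)
    (W : R -> Om -> V) (sigma : R -> Om -> 'M[R]_d) (xi : V) : Prop :=
  sde_solution P W sigma xi id /\
  forall X : Om -> Om, sde_solution P W sigma xi X ->
    \forall w \ae P, X w = w.

Definition diffusion_coefficient (sigma : R -> Om -> 'M[R]_d) : Prop :=
  [/\ progressive raw_filtration sigma,
      exists2 C : R, 0 < C & forall t, horizon t -> forall w w',
        enorm (sigma t w - sigma t w') <= C * path_sub_sup t w w',
      forall t, horizon t -> forall w, sigma t w \in unitmx &
      exists K : R, forall t, horizon t -> forall w,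
        enorm (sigma t w) <= K /\ enorm (invmx (sigma t w)) <= K].

End processes.

Section control.
Context (R : realType) (T : {posnum R}) (d : nat) (U : metricType R).
Local Notation Om := (Path T d).
Local Notation horizon := (horizon T).
Local Notation V := ('cV[R]_d).
Local Notation PR := (probability (Rd R d) R).

Definition marginal (Q : probability Om R) (t : R) : PR :=
  distribution Q (coord t).

Definition controls (P : probability Om R) : set (R -> Om -> U) :=
  [set u | progressive (filtration P) u].

Definition coef_measurable (S : topologicalType)
    (phi : R -> Om -> PR -> U -> S) : Prop :=
  forall B, borel S B ->
    prod_sigma (@measurable _ R) (prod_sigma (@measurable _ Om)
        (prod_sigma (@tv_borel R d) (borel U)))
      [set p | horizon p.1 /\ B (phi p.1 p.2.1 p.2.2.1 p.2.2.2)].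

Definition coef_progressive (S : topologicalType) (P : probability Om R)
    (phi : R -> Om -> PR -> U -> S) : Prop :=
  forall u, controls P u -> forall Q : probability Om R,
    progressive (filtration P) (fun t w => phi t w (marginal Q t) (u t w)).

Definition drift_coefficient (P : probability Om R)
    (f : R -> Om -> PR -> U -> V) : Prop :=
  [/\ coef_measurable f, coef_progressive P f,
      exists C : R, forall t, horizon t -> forall w mu nu u v,
        enorm (f t w mu u - f t w nu v) <= C * (tv_dist mu nu + mdist u v) &
      exists C : R, forall t, horizon t -> forall w mu u,
        enorm (f t w mu u) <= C * (1 + path_sup t w)].

Definition running_cost (P : probability Om R)
    (h : R -> Om -> PR -> U -> R) : Prop :=
  [/\ coef_measurable h, coef_progressive P h,
      exists C : R, forall t, horizon t -> forall w mu nu u v,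
        `|h t w mu u - h t w nu v| <= C * (tv_dist mu nu + mdist u v) &
      exists K : R, forall t, horizon t -> forall w mu u, `|h t w mu u| <= K].

Definition terminal_cost (P : probability Om R) (g : V -> PR -> R) : Prop :=
  [/\ forall B, borel R B ->
        prod_sigma (borel V) (@tv_borel R d) [set p | B (g p.1 p.2)],
      forall Q : probability Om R, measurable_wrt (filtration P T%:num)
        (fun w => g (coord T%:num w) (marginal Q T%:num)),
      exists C : R, forall y mu nu, `|g y mu - g y nu| <= C * tv_dist mu nu &
      exists K : R, forall y mu, `|g y mu| <= K].

Section cost.
Context (P : probability Om R) (W : R -> Om -> V) (sigma : R -> Om -> 'M[R]_d)
  (f : R -> Om -> PR -> U -> V) (h : R -> Om -> PR -> U -> R) (g : V -> PR -> R).

(* dQ = L_T dP with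
   L = Exp (int_0^. sigma^-1(s, x) f(s, x, Q o x_s^-1, u_s) . dW_s). *)
Definition is_controlled_law (u : R -> Om -> U) (Q : probability Om R) : Prop :=
  exists M QV : R -> Om -> R,
    [/\ is_ito_integral P W
          (fun t w => invmx (sigma t w) *m f t w (marginal Q t) (u t w)) M,
        is_quadratic_variation P M QV &
        forall A, @measurable _ Om A ->
          Q A = (\int[completion P]_(w in A) (doleans_exp M QV T%:num w)%:E)%E].

(* The law P^u; under the standing assumptions is_controlled_law u has exactly
   one element, so that the default value P of xget is never used. *)
Definition controlled_law (u : R -> Om -> U) : probability Om R :=
  xget P [set Q | is_controlled_law u Q].

Definition cost (u : R -> Om -> U) : \bar R :=
  let Q := controlled_law u in
  'E_(completion Q)[fun w =>
     \int[lebesgue_measure]_(t in horizon) h t w (marginal Q t) (u t w)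
     + g (coord T%:num w) (marginal Q T%:num)].

End cost.
End control.

(* Main.v *)
Require Import Defs.
From HB Require Import structures.
From mathcomp Require Import all_boot all_order all_algebra.
From mathcomp Require Import all_classical all_reals all_analysis.
Import Order.TTheory GRing.Theory Num.Theory.
Import numFieldNormedType.Exports.
Local Open Scope classical_set_scope.
Local Open Scope ring_scope.

(* Since h and g are bounded, the cost functional is bounded below uniformly in
   the control. Hence its infimum over the nonempty set of controls is not -oo,
   and is approached within any eps > 0. *)

(* The integral of a nonnegative function is a supremum over the simple
   functions below it, so its monotonicity needs no measurability. *)
Lemma ge0_le_integral_nonmeasurable d (S : measurableType d) (R : realType)
    (mu : {measure set S -> \bar R}) (D : set S) (f1 f2 : S -> \bar R) :
  (forall x, D x -> 0 <= f1 x)%E -> (forall x, D x -> f1 x <= f2 x)%E ->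
  (\int[mu]_(x in D) f1 x <= \int[mu]_(x in D) f2 x)%E.
Proof.
move=> f10 f12.
have f20 x : D x -> (0 <= f2 x)%E.
  by move=> Dx; exact: le_trans (f10 _ Dx) (f12 _ Dx).
rewrite !ge0_integralE//; apply: le_ereal_sup => _ [s /= sf <-].
exists s => // x; apply: (le_trans (sf x)).
by rewrite /patch; case: ifPn => // /set_mem; exact: f12.
Qed.

(** The positive part of [f] contributes at least 0, and the negative part at most [c] times the
    mass of [D]. As [f] is arbitrary, the cost can be bounded without examining the measurability of
    its integrands. *)
Lemma integral_ge_cst d (S : measurableType d) (R : realType)
    (mu : {measure set S -> \bar R}) (D : set S) (f : S -> \bar R) (c : R) :
  measurable D -> 0 <= c -> (forall x, D x -> (- c)%:E <= f x)%E ->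
  (- (c%:E * mu D) <= \int[mu]_(x in D) f x)%E.
Proof.
move=> mD c0 fc; rewrite integralE -[leLHS]add0e; apply: leeB.
  exact: integral_ge0.
rewrite -integral_cst//; apply: ge0_le_integral_nonmeasurable => // x Dx.
by rewrite funenegE ge_max lee_fin c0 andbT leeNl; exact: fc.
Qed.

Lemma Rintegral_ge_cst d (S : measurableType d) (R : realType)
    (mu : {measure set S -> \bar R}) (D : set S) (f : S -> R) (c : R) :
  measurable D -> (mu D < +oo)%E -> 0 <= c -> (forall x, D x -> - c <= f x) ->
  - (c * fine (mu D)) <= \int[mu]_(x in D) f x.
Proof.
move=> mD muD c0 fc; rewrite /Rintegral.
have muDfin : mu D \is a fin_num by rewrite ge0_fin_numE.
have : (- (c * fine (mu D))%:E <= \int[mu]_(x in D) (f x)%:E)%E.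
  by rewrite EFinM fineK//; apply: integral_ge_cst.
(* The bound rules out [-oo]; at [+oo] the real-valued integral defaults to 0, which still respects
   the bound because [c] is nonnegative. *)
case: (integral _ _ _) => [r| |] //= _.
by rewrite oppr_le0 mulr_ge0// fine_ge0.
Qed.

Lemma expectation_ge_cst d (S : measurableType d) (R : realType)
    (Q : probability S R) (X : S -> R) (c : R) :
  0 <= c -> (forall x, - c <= X x) -> ((- c)%:E <= 'E_Q[X])%E.
Proof.
move=> c0 Xc; rewrite unlock.
have := @integral_ge_cst _ _ _ Q setT (EFin \o X) c measurableT c0.
rewrite (_ : _ [set: S] = 1%E) ?mule1; last exact: (probability_setT Q).
by apply=> x _ /=; rewrite lee_fin.
Qed.

(** For given [t] and [B], the set to be tested is the rectangle of [[0, t]] and the whole path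
    space if [B] contains [u0], and empty otherwise. *)
Lemma constant_control (R : realType) (T : {posnum R}) (d : nat)
    (U : metricType R) (P : probability (Path T d) R) (u0 : U) :
  controls P (fun _ _ => u0).
Proof.
move=> t _ B _; have [Bu0|nBu0] := pselect (B u0); last first.
  rewrite (_ : [set _ | _] = set0); first exact: sigma_algebra0.
  by apply/seteqP; split => // p [].
apply: sub_sigma_algebra; exists [set` `[0, t]]; first exact: measurable_itv.
exists setT; last first.
  by apply/seteqP; split => p /=; rewrite in_itv /=; [case|move=> [+ _]].
(* The full space lies in the filtration as the complement of the empty set. *)
rewrite -(setD0 setT); apply: sigma_algebraCD; exact: sigma_algebra0.
Qed.

(** The bounds on [h] and [g] are uniform in their measure argument, so one constant serves whatever
    law [controlled_law] selects. *)
Lemma cost_bounded_below (R : realType) (T : {posnum R}) (d : nat)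
    (U : metricType R) (P : probability (Path T d) R)
    (W : R -> Path T d -> 'cV[R]_d) (sigma : R -> Path T d -> 'M[R]_d)
    (f : R -> Path T d -> probability (Rd R d) R -> U -> 'cV[R]_d)
    (h : R -> Path T d -> probability (Rd R d) R -> U -> R)
    (g : 'cV[R]_d -> probability (Rd R d) R -> R) :
  running_cost P h -> terminal_cost P g ->
  exists K : R, forall u, (K%:E <= cost P W sigma f h g u)%E.
Proof.
move=> [_ _ _ [Kh hK]] [_ _ _ [Kg gK]].
have horizonfin : (lebesgue_measure (horizon T) < +oo)%E.
  by rewrite /horizon lebesgue_measure_itv /=; case: ifP; rewrite ?ltry.
(* Absolute values, because [Kh] and [Kg] come without a sign while the integral bounds ask for a
   nonnegative constant. *)
exists (- (`|Kh| * fine (lebesgue_measure (horizon T)) + `|Kg|)) => u.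
apply: expectation_ge_cst; first by rewrite addr_ge0// mulr_ge0// fine_ge0.
move=> w; rewrite opprD lerD//.
  apply: Rintegral_ge_cst => // [|t tT]; first exact: measurable_itv.
  by rewrite lerNl (le_trans (ler_norm _))// normrN (le_trans (hK _ _ _ _ _))//
    ler_norm.
by rewrite lerNl (le_trans (ler_norm _))// normrN (le_trans (gK _ _))// ler_norm.
Qed.

Theorem proposition4p11 (R : realType) (T : {posnum R}) (d : nat)
  (hd : (0 < d)%N) (xi : 'cV[R]_d)
  (sigma : R -> Path T d -> 'M[R]_d) (hsigma : diffusion_coefficient sigma)
  (P : probability (Path T d) R) (W : R -> Path T d -> 'cV[R]_d)
  (hW : brownian P W) (hx : coordinate_unique_solution P W sigma xi)
  (U : metricType R) (hU : compact [set: U]) (hU0 : [set: U] !=set0)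
  (f : R -> Path T d -> probability (Rd R d) R -> U -> 'cV[R]_d)
  (hf : drift_coefficient P f)
  (h : R -> Path T d -> probability (Rd R d) R -> U -> R)
  (hh : running_cost P h)
  (g : 'cV[R]_d -> probability (Rd R d) R -> R)
  (hg : terminal_cost P g) :
  forall eps : R, 0 < eps ->
    exists2 u : R -> Path T d -> U, controls P u &
      (cost P W sigma f h g u <=
       ereal_inf [set cost P W sigma f h g v | v in controls P] + eps%:E)%E.
Proof.
move=> eps eps0; set J := [set _ | _ in _].
have [u0 _] := hU0.
have [K costK] := cost_bounded_below _ _ _ _ _ W sigma f _ _ hh hg.
have infNy : ereal_inf J != -oo%E.
  rewrite -ltNye; apply: (@lt_le_trans _ _ K%:E); first exact: ltNyr.
  by apply: le_ereal_inf_tmp => _ [u _ <-].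
(* An infimum [+oo] makes the right-hand side [+oo], so any control will do. *)
have [infy|infNpy] := eqVneq (ereal_inf J) +oo%E.
  by exists (fun _ _ => u0); [exact: constant_control|rewrite infy addye// leey].
(* For a finite infimum, adding [eps] gives a number that is no longer a lower bound, so some
   control has cost below it. *)
have /(lb_ereal_inf_adherent eps0)[_ [u uP <-] /ltW uJ] :
    ereal_inf J \is a fin_num by rewrite fin_numE infNy.
by exists u.
Qed.
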